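(* For every $\varepsilon>0$ there exists $n_0$ such that every triangle-free graph $G$ of order $n \ge n_0$ satisfies $\vec{\chi}(G) \le (1+\varepsilon) \sqrt{\frac{2n}{\ln n}}$. (That is, $\vec\chi(G)\le(1+o(1))\sqrt{2n/\ln n}$ as $n\to\infty$; in particular the maximum dichromatic number $\vec t(n)$ of an oriented triangle-free graph of order $n$ satisfies $\vec t(n)\le (\sqrt2+o(1))\sqrt{n/\ln n}$.)
   Context: For an undirected graph $G$, $\vec\chi(G)$ is the maximum, over all orientations $\vec G$ of $G$, of the dichromatic number of $\vec G$; the dichromatic number of a digraph is the least $k$ such that its vertex set can be partitioned into $k$ sets each inducing a subdigraph with no directed cycle. *)

(* Defs.v *)
From HB Require Import structures.
From mathcomp Require Import all_boot all_order all_algebra.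
From mathcomp Require Import boolp reals exp.

Set Implicit Arguments.
Unset Strict Implicit.
Unset Printing Implicit Defensive.

(* Graphs and digraphs on a fixed finite vertex type are elements of finite
   types, so that maxima over orientations and over graphs are \max_ bigops. *)

Definition sgraph (T : finType) : finType :=
  {E : {set {set T}} | [forall e in E, #|e| == 2]}.

(* Irreflexive: the singleton [set x; x] is never an edge. *)
Definition edge (T : finType) (G : sgraph T) : rel T :=
  fun x y => [set x; y] \in val G.

Definition digraph (T : finType) : finType :=
  {A : {set T * T} | [forall x, (x, x) \notin A]}.

Definition arc (T : finType) (D : digraph T) : rel T :=
  fun x y => (x, y) \in val D.

Definition triangle_free (T : finType) (G : sgraph T) : bool :=
  ~~ [exists x, exists y, exists z, [&& edge G x y, edge G y z & edge G z x]].

Definition is_orientation (T : finType) (G : sgraph T) (D : digraph T) : bool :=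
  [forall x, forall y,
     if edge G x y then arc D x y (+) arc D y x else ~~ arc D x y].

Definition directed_cycle (T : finType) (D : digraph T) (c : seq T) : bool :=
  [&& c != [::], uniq c & cycle (arc D) c].

Definition induces_acyclic (T : finType) (D : digraph T) (A : {set T}) : Prop :=
  forall c : seq T, directed_cycle D c -> ~ {subset c <= A}.

Definition acyclic_partition (T : finType) (D : digraph T) (k : nat) : Prop :=
  exists P : {set {set T}},
    [/\ partition P [set: T], #|P| = k
      & forall A : {set T}, A \in P -> induces_acyclic D A].

Lemma acyclic_partition_exists (T : finType) (D : digraph T) :
  exists k, `[< acyclic_partition D k >].
Proof.
pose P := [set [set x] | x : T].
exists #|P|; apply/asboolP; exists P; split => //.
- apply/and3P; split.
  + apply/eqP/setP => x; rewrite !inE; apply/bigcupP.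
    by exists [set x]; rewrite ?inE //; apply: imset_f.
  + apply/trivIsetP => A B /imsetP[x _ ->] /imsetP[y _ ->] ne.
    rewrite disjoints1 inE; apply: contraNN ne => /eqP ->; exact: eqxx.
  + by apply/imsetP => -[x _ /setP /(_ x)]; rewrite !inE eqxx.
- move=> A /imsetP[x _ ->] [|y [|z c]] // /and3P[_ uc cc] sub.
  + move: cc; rewrite /= andbT /arc.
    by rewrite (negbTE (forallP (valP D) y)).
  + have /set1P ey : y \in [set x] by apply: sub; rewrite inE eqxx.
    have /set1P ez : z \in [set x] by apply: sub; rewrite !inE eqxx orbT.
    by move: uc; rewrite /= ey ez inE eqxx.
Qed.

Definition dichromatic_number (T : finType) (D : digraph T) : nat :=
  ex_minn (acyclic_partition_exists D).

Definition graph_dichromatic_number (T : finType) (G : sgraph T) : nat :=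
  \max_(D : digraph T | is_orientation G D) dichromatic_number D.

(* Every graph of order n is isomorphic to one on 'I_n. *)
Definition max_triangle_free_dichromatic (n : nat) : nat :=
  \max_(G : sgraph 'I_n | triangle_free G) graph_dichromatic_number G.

(* Main.v *)
(** Given an orientation D of a triangle-free graph G, choose a minimum feedback
    arc set F of D.  By minimality, at every vertex v the arcs of F number at most
    min(outdegree, indegree) <= deg(v) / 2, and a proper coloring of the graph
    formed by F is a partition of D into acyclic sets.  This halving of the degree
    combines with the bound chi <= (1 + o(1)) Delta / ln Delta for triangle-free
    graphs: k colors suffice if all degrees are at most about 2 k ln k.

    The latter bound is proved by counting: adding a vertex v to S multiplies the
    number of proper colorings of S by at least some l.  Conditionally on the
    colors outside N(v), the neighbors of v are independent and uniform on their
    available colors, and by induction few of them have few available colors.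

    If some degree exceeds 2 k ln k with k ~ sqrt(2 m / ln n), m being the number
    of remaining vertices, then the neighborhood of such a vertex is removed as one
    color class; summing over these steps gives c sqrt n with c ~ sqrt(2 / ln n).
    Once few vertices remain, ln k is too small compared with ln n / 2, and a crude
    bound O(sqrt m), itself obtained by the same peeling with constant parameters,
    is enough. *)

Require Import Defs.
From HB Require Import structures.
From mathcomp Require Import all_boot all_order all_algebra.
From mathcomp Require Import boolp reals exp.
From mathcomp Require Import sequences.
From mathcomp Require Import ring lra.
Import Order.TTheory GRing.Theory Num.Theory.
Local Open Scope ring_scope.

(** * Lower bounds for sums of products of probabilities *)

(** With [q = (1 + eta) * p], it suffices that [(1 - p) * (1 + q) >= 1], because [expR q >= 1 + q].
    The product exceeds 1 by [p * (eta - q)]. *)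
Lemma expR_le_one_sub (R : realType) (eta p : R) :
  0 < eta -> 0 <= p -> (1 + eta) * p <= eta -> expR (- ((1 + eta) * p)) <= 1 - p.
Proof.
move=> eta0 p0 hp.
have q0 : 0 < 1 + (1 + eta) * p by nra.
rewrite expRN -[leLHS]mul1r ler_pdivrMr ?expR_gt0 //.
apply: (@le_trans _ _ ((1 - p) * (1 + (1 + eta) * p))); first by nra.
by rewrite ler_wpM2l ?expR_ge1Dx //; nra.
Qed.

Lemma one_sub_sum_le_prod (R : realType) (I : finType) (B : {set I}) (p : I -> R) :
  (forall u, u \in B -> 0 <= p u <= 1) ->
  1 - \sum_(u in B) p u <= \prod_(u in B) (1 - p u).
Proof.
move=> hp.
(* The induction needs the partial products to stay in [0, 1]. *)
suff [] : 1 - \sum_(u in B) p u <= \prod_(u in B) (1 - p u) /\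
          0 <= \prod_(u in B) (1 - p u) <= 1 by [].
elim/big_rec2: _ => [|u y1 y2 /hp/andP[p0 p1] [IH /andP[y0 y1']]]; first by lra.
by split; [nra | apply/andP; split; nra].
Qed.

(* Each weight [w = max 0 (1 - b)] lies in [0, 1], and exp is bounded below by
   its tangent line at [- a]; this turns the sum of products into linear sums. *)
Lemma sum_prod_one_sub_ge (R : realType) (I J : finType) (N B : {set I})
    (p : I -> J -> R) (eta a : R) :
  0 < eta -> 0 <= a -> B \subset N ->
  (1 + eta) * #|N|%:R <= a * #|J|%:R ->
  (forall u c, u \in N -> 0 <= p u c <= 1) ->
  (forall u, u \in N -> \sum_c p u c = 1) ->
  (forall u c, u \in N :\: B -> (1 + eta) * p u c <= eta) ->
  expR (- a) * (#|J|%:R - (1 + a) * #|B|%:R)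
    <= \sum_c \prod_(u in N) (1 - p u c).
Proof.
move=> eta0 a0 BN hN hp hs hg.
pose b c := \sum_(u in B) p u c; pose s c := \sum_(u in N :\: B) p u c.
pose w c := Num.max 0 (1 - b c).
have b0 c : 0 <= b c.
  by apply: sumr_ge0 => u uB; case/andP: (hp u c (subsetP BN _ uB)).
have s0 c : 0 <= s c.
  by apply: sumr_ge0 => u /setDP[uN _]; case/andP: (hp u c uN).
have wP c : [/\ 0 <= w c, w c <= 1 & 1 - b c <= w c].
  by rewrite /w !le_max ge_max !lexx ler01 /= orbT; split => //; move: (b0 c); lra.
have sumb : \sum_c b c = #|B|%:R.
  rewrite /b exchange_big /= -sumr_const; apply: eq_bigr => u uB.
  by rewrite hs // (subsetP BN).
have sums : (1 + eta) * \sum_c s c <= a * #|J|%:R.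
  apply: le_trans hN; apply: ler_wpM2l; first by lra.
  rewrite /s exchange_big /= (eq_bigr (fun=> 1)) => [|u /setDP[uN _]]; last exact: hs.
  by rewrite sumr_const ler_nat subset_leq_card // subsetDl.
have key c : expR (- a) * ((1 + a) * w c - (1 + eta) * s c)
    <= \prod_(u in N) (1 - p u c).
  have [w0 w1 bw] := wP c.
  rewrite (big_setID B) /= (setIidPr BN).
  have PB0 : 0 <= \prod_(u in B) (1 - p u c).
    by apply: prodr_ge0 => u uB; case/andP: (hp u c (subsetP BN _ uB)) => _; lra.
  have PB : w c <= \prod_(u in B) (1 - p u c).
    rewrite /w ge_max PB0 /=; apply: one_sub_sum_le_prod => u uB.
    exact: hp (subsetP BN _ uB).
  have PG : expR (- a) * (1 + a - (1 + eta) * s c)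
      <= \prod_(u in N :\: B) (1 - p u c).
    apply: (@le_trans _ _ (expR (- ((1 + eta) * s c)))).
      have -> : - ((1 + eta) * s c) = - a + (a - (1 + eta) * s c) by ring.
      rewrite expRD ler_wpM2l ?expR_ge0 //.
      by apply: le_trans (expR_ge1Dx _); lra.
    rewrite /s mulr_sumr -sumrN expR_sum.
    apply: ler_prod => u uNB; rewrite expR_ge0 /=.
    have /setDP[uN _] := uNB.
    apply: expR_le_one_sub => //; first by case/andP: (hp u c uN).
    exact: hg.
  have PG0 : 0 <= \prod_(u in N :\: B) (1 - p u c).
    by apply: prodr_ge0 => u /setDP[uN _]; case/andP: (hp u c uN) => _; lra.
  apply: (@le_trans _ _ (w c * \prod_(u in N :\: B) (1 - p u c))); last first.
    exact: ler_wpM2r.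
  apply: le_trans (ler_wpM2l w0 PG).
  rewrite mulrCA ler_wpM2l ?expR_ge0 //.
  (* Since [w c <= 1], replacing [w c * s c] by [s c] only weakens the bound, and makes it
     linear. *)
  have : 0 <= (1 + eta) * (s c * (1 - w c)).
    by rewrite mulr_ge0 ?mulr_ge0 ?subr_ge0 //; lra.
  lra.
apply: (@le_trans _ _ (\sum_c expR (- a) * ((1 + a) * w c - (1 + eta) * s c))); last first.
  by apply: ler_sum => c _; exact: key.
rewrite -mulr_sumr ler_wpM2l ?expR_ge0 // sumrB -!mulr_sumr.
have : #|J|%:R - #|B|%:R <= \sum_c w c.
  rewrite -sumb -[X in X - _](sumr_const J (1 : R)) -sumrB.
  by apply: ler_sum => c _; case: (wP c).
nra.
Qed.

(** Divide by the product of the list sizes: [p u c] is the probability that a uniform color of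
    [L u] equals [c]. Vertices with lists of size at most [t0] are exceptional; for the others
    [p u c < 1 / t0], small enough for the exponential estimate. *)
Lemma sum_prod_card_setD1_ge (R : realType) (I J : finType) (N : {set I})
    (L : I -> {set J}) (eta a t0 : R) :
  0 < eta -> 0 <= a -> (1 + eta) * #|N|%:R <= a * #|J|%:R ->
  1 + eta <= eta * t0 -> (forall u, u \in N -> L u != set0) ->
  expR (- a) * (#|J|%:R - (1 + a) * #|[set u in N | #|L u|%:R <= t0]|%:R)
      * \prod_(u in N) #|L u|%:R
    <= \sum_c \prod_(u in N) #|L u :\ c|%:R.
Proof.
move=> eta0 a0 hN ht hL; set B := [set _ in N | _].
pose p u c : R := (c \in L u)%:R / #|L u|%:R.
have L0 u : u \in N -> 0 < #|L u|%:R :> R.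
  by move=> uN; rewrite ltr0n card_gt0 hL.
have pE c : \prod_(u in N) #|L u :\ c|%:R
    = (\prod_(u in N) (1 - p u c)) * \prod_(u in N) #|L u|%:R.
  rewrite -big_split /=; apply: eq_bigr => u uN.
  rewrite mulrBl mul1r divfK ?gt_eqF ?L0 //.
  by rewrite (cardsD1 c (L u)) natrD addrAC subrr add0r.
rewrite (eq_bigr _ (fun c _ => pE c)) -mulr_suml.
apply: ler_wpM2r; first by apply: prodr_ge0 => u _; rewrite ler0n.
apply: (@sum_prod_one_sub_ge _ _ _ N B p eta a) => //.
- by apply/subsetP => u; rewrite inE => /andP[].
- move=> u c uN; have := L0 u uN => Lu; rewrite /p divr_ge0 ?ler0n //=.
  rewrite ler_pdivrMr // mul1r ler_nat.
  by case: (boolP (c \in L u)) => // cL; rewrite card_gt0 hL.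
- move=> u uN; rewrite /p -mulr_suml.
  rewrite -natr_sum -big_mkcond /= sum1_card divff // gt_eqF ?L0 //.
- move=> u c /setDP[uN]; rewrite inE uN /= -ltNge => tL.
  have Lu := L0 u uN.
  rewrite /p mulrA ler_pdivrMr //.
  case: (c \in L u) => /=; rewrite ?mulr1 ?mulr0; nra.
Qed.

(** * Counting proper colorings of triangle-free graphs *)

Definition proper_on {T : finType} (e : rel T) (k : nat) (S : {set T})
    (f : {ffun T -> 'I_k}) : bool :=
  [forall x in S, forall y in S, e x y ==> (f x != f y)].

Definition available {T : finType} (e : rel T) (k : nat) (S : {set T})
    (f : {ffun T -> 'I_k}) (u : T) : {set 'I_k} :=
  [set c | [forall w in S, e u w ==> (f w != c)]].

(* Colorings are defined on all of T and unconstrained outside S, so this is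
   k ^ (#|T| - #|S|) times the number of proper colorings of S. *)
Definition nproper {T : finType} (e : rel T) (k : nat) (S : {set T}) : nat :=
  #|[set f : {ffun T -> 'I_k} | proper_on e k S f]|.

Lemma proper_onP (T : finType) (e : rel T) (k : nat) (S : {set T})
    (f : {ffun T -> 'I_k}) :
  reflect {in S &, forall x y, e x y -> f x != f y} (proper_on e k S f).
Proof.
apply: (iffP 'forall_in_'forall_in_implyP) => [h x y xS yS exy | h x xS y yS exy].
  exact: h.
exact: h.
Qed.

Lemma availableP (T : finType) (e : rel T) (k : nat) (S : {set T})
    (f : {ffun T -> 'I_k}) (u : T) (c : 'I_k) :
  reflect {in S, forall w, e u w -> f w != c} (c \in available e k S f u).
Proof. by rewrite inE; apply: 'forall_in_implyP. Qed.

Lemma eq_proper_on (T : finType) (e : rel T) (k : nat) (S : {set T})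
    (f g : {ffun T -> 'I_k}) :
  {in S, f =1 g} -> proper_on e k S f = proper_on e k S g.
Proof.
move=> fg; apply/proper_onP/proper_onP => h x y xS yS exy.
  by rewrite -!fg // h.
by rewrite !fg // h.
Qed.

Lemma eq_available (T : finType) (e : rel T) (k : nat) (S : {set T})
    (f g : {ffun T -> 'I_k}) (u : T) :
  {in S, forall w, e u w -> f w = g w} ->
  available e k S f u = available e k S g u.
Proof.
move=> fg; apply/setP => c; apply/availableP/availableP => h w wS euw.
  by rewrite -fg // h.
by rewrite fg // h.
Qed.

Lemma available_setD1 (T : finType) (e : rel T) (k : nat) (S : {set T})
    (f : {ffun T -> 'I_k}) (u : T) :
  irreflexive e -> available e k (S :\ u) f u = available e k S f u.
Proof.
move=> eirr; apply/setP => c; apply/availableP/availableP => h w.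
  by move=> wS euw; apply: h => //; rewrite !inE wS andbT;
    apply: contraTneq euw => ->; rewrite eirr.
by move=> /setD1P[_ wS]; apply: h.
Qed.

Lemma proper_onU1 (T : finType) (e : rel T) (k : nat) (S : {set T})
    (f : {ffun T -> 'I_k}) (v : T) :
  symmetric e -> irreflexive e ->
  proper_on e k (v |: S) f =
  proper_on e k S f && (f v \in available e k S f v).
Proof.
move=> esym eirr; apply/proper_onP/andP.
  move=> h; split.
    by apply/proper_onP => x y xS yS; apply: h; rewrite inE ?xS ?yS orbT.
  by apply/availableP => w wS evw; apply: h; rewrite ?setU11 ?inE ?wS ?orbT // esym.
case=> /proper_onP h /availableP hv x y /setU1P[->|xS] /setU1P[->|yS] exy.
- by rewrite eirr in exy.
- by rewrite eq_sym hv.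
- by rewrite hv // esym.
- exact: h.
Qed.

(* Resampling the color of u: (f, c) |-> (f[u := c], f u) is an involution. *)
Lemma sum_card_resample (T : finType) (k : nat) (u : T)
    (Q : pred {ffun T -> 'I_k}) (A : {ffun T -> 'I_k} -> {set 'I_k}) :
  (forall f g : {ffun T -> 'I_k}, (forall x, x != u -> f x = g x) ->
    Q f = Q g /\ A f = A g) ->
  (\sum_(f | Q f) #|A f| = k * #|[set f | Q f & f u \in A f]|)%N.
Proof.
move=> QA.
pose upd (f : {ffun T -> 'I_k}) c := [ffun x => if x == u then c else f x].
have updE f c : Q (upd f c) = Q f /\ A (upd f c) = A f.
  by apply: QA => x xu; rewrite ffunE (negPf xu).
pose swap (p : {ffun T -> 'I_k} * 'I_k) := (upd p.1 p.2, p.1 u).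
have swapK : involutive swap.
  case=> f c; rewrite /swap /=; congr pair; last by rewrite ffunE eqxx.
  by apply/ffunP => x; rewrite !ffunE; case: eqP => // ->.
transitivity (\sum_(p : {ffun T -> 'I_k} * 'I_k | Q p.1 && (p.2 \in A p.1)) 1)%N.
  rewrite -(pair_big_dep Q (fun f c => c \in A f) (fun _ _ => 1%N)) /=.
  by apply: eq_bigr => f _; rewrite sum1_card.
rewrite (reindex_inj (inv_inj swapK)) /=.
transitivity (\sum_(p : {ffun T -> 'I_k} * 'I_k | (Q p.1 && (p.1 u \in A p.1)) && true) 1)%N.
  by apply: eq_bigl => -[f c] /=; have [-> ->] := updE f c; rewrite andbT.
rewrite -(pair_big_dep (fun f => Q f && (f u \in A f)) (fun _ _ => true) (fun _ _ => 1%N)) /=.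
rewrite (eq_bigr (fun=> k)) => [|f _]; last by rewrite sum1_card card_ord.
by rewrite sum_nat_const mulnC cardsE.
Qed.

(** The factor [k] appears because the color of [v] is unconstrained in a coloring that is proper on
    [S]. *)
Lemma sum_available (T : finType) (e : rel T) (k : nat) (S : {set T}) (v : T) :
  symmetric e -> irreflexive e -> v \notin S ->
  (\sum_(f | proper_on e k S f) #|available e k S f v|
    = k * nproper e k (v |: S))%N.
Proof.
move=> esym eirr vS; rewrite (sum_card_resample _ _ v) => [|f g fg].
  rewrite /nproper; congr (_ * _)%N; apply: eq_card => f.
  by rewrite [LHS]inE [RHS]inE proper_onU1.
have fgS : {in S, f =1 g}.
  by move=> x xS; apply: fg; apply: contraNneq vS => <-.
by split; [apply: eq_proper_on | apply: eq_available => w wS _; apply: fgS].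
Qed.

(** The list of [u] does not depend on the color of [u]. Resampling that color, at most [t0] of its
    [k] values extend a given proper coloring of [S :\ u] with a short list at [u]. *)
Lemma card_few_available (R : realType) (T : finType) (e : rel T) (k : nat)
    (S : {set T}) (u : T) (t0 : R) :
  symmetric e -> irreflexive e -> u \in S -> 0 <= t0 ->
  k%:R * #|[set f | proper_on e k S f & #|available e k S f u|%:R <= t0]|%:R
    <= t0 * (nproper e k (S :\ u))%:R.
Proof.
move=> esym eirr uS t0_ge0.
pose S' := S :\ u.
pose Q f := proper_on e k S' f && (#|available e k S' f u|%:R <= t0).
have QA (f g : {ffun T -> 'I_k}) : (forall x, x != u -> f x = g x) ->
    Q f = Q g /\ available e k S' f u = available e k S' g u.
  move=> fg.
  have fgS : {in S', f =1 g} by move=> x /setD1P[xu _]; apply: fg.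
  have Ag : available e k S' f u = available e k S' g u.
    by apply: eq_available => w wS _; apply: fgS.
  by rewrite /Q Ag (eq_proper_on _ _ _ _ _ _ fgS).
have -> : [set f | proper_on e k S f & #|available e k S f u|%:R <= t0]
    = [set f | Q f & f u \in available e k S' f u].
  apply/setP => f; rewrite [LHS]inE [RHS]inE /Q -{1}(setD1K uS) proper_onU1 //.
  by rewrite /S' available_setD1 // andbAC.
rewrite -natrM -(sum_card_resample _ _ u Q _ QA) natr_sum.
apply: (@le_trans _ _ (\sum_(f | Q f) t0)).
  by apply: ler_sum => f /andP[].
rewrite sumr_const -[leLHS]mulr_natr ler_wpM2l // ler_nat.
by rewrite /nproper cardsE; apply: subset_leq_card; apply/subsetP => f /andP[].
Qed.

Lemma card_product_off_fixed (T : finType) (k : nat) (N : {set T})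
    (f0 : {ffun T -> 'I_k}) (L : T -> {set 'I_k}) :
  #|[set f : {ffun T -> 'I_k} |
      [forall x, if x \in N then f x \in L x else f x == f0 x]]|
  = (\prod_(u in N) #|L u|)%N.
Proof.
pose F x : {set 'I_k} := if x \in N then L x else [set f0 x].
transitivity #|(family F : simpl_pred {ffun T -> 'I_k})|.
  apply: eq_card => f; rewrite inE; apply: eq_forallb => x.
  change ((if x \in N then f x \in L x else f x == f0 x) = (f x \in F x)).
  by rewrite /F; case: ifP => // _; rewrite inE.
rewrite card_family foldrE big_map big_enum /= [RHS]big_mkcond /=.
by apply: eq_bigr => x _; rewrite /F; case: ifP => // _; rewrite cards1.
Qed.

(** As [N] is independent, each vertex of [N] is constrained only by vertices outside [N], where [f]
    agrees with [f0]. *)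
Lemma proper_on_off_fixed (T : finType) (e : rel T) (k : nat) (S N : {set T})
    (f0 f : {ffun T -> 'I_k}) :
  symmetric e -> N \subset S -> {in N &, forall x y, ~~ e x y} ->
  proper_on e k S f0 -> (forall x, x \notin N -> f x = f0 x) ->
  proper_on e k S f = [forall x in N, f x \in available e k S f0 x].
Proof.
move=> esym NS indep /proper_onP h0 ff0.
apply/proper_onP/forall_inP => [h x xN | h x y xS yS exy].
  apply/availableP => w wS exw; rewrite -ff0.
    by rewrite eq_sym h // (subsetP NS).
  by apply: contraTN exw => wN; apply: indep.
have nin a b : a \in N -> e a b -> b \notin N.
  by move=> aN; apply: contraTN => bN; apply: indep.
case: (boolP (x \in N)) => xN.
  have /availableP hx := h x xN.
  by rewrite (ff0 y) ?(nin x) // eq_sym hx.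
case: (boolP (y \in N)) => yN.
  have /availableP hy := h y yN.
  by rewrite (ff0 x) // hy // esym.
by rewrite !ff0 // h0.
Qed.

(** The key by which colorings are grouped into classes: erasing the values on [N] fixes the colors
    outside [N]. *)
Definition restrict_off {T : finType} {k : nat} (N : {set T})
    (f : {ffun T -> 'I_k}) : {ffun T -> option 'I_k} :=
  [ffun x => if x \in N then None else Some (f x)].

Lemma restrict_off_eq (T : finType) (k : nat) (N : {set T})
    (f g : {ffun T -> 'I_k}) :
  reflect (forall x, x \notin N -> f x = g x)
    (restrict_off N f == restrict_off N g).
Proof.
apply: (iffP eqP) => [/ffunP fg x xN | fg].
  by have := fg x; rewrite !ffunE (negPf xN) => -[].
by apply/ffunP => x; rewrite !ffunE; case: (boolP (x \in N)) => // /fg ->.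
Qed.

(** In a class the colors on [N] vary independently over the available lists. The extra lists [D]
    serve to count either the whole class or the colorings avoiding a color on [N]. *)
Lemma card_proper_class (T : finType) (e : rel T) (k : nat) (S N : {set T})
    (f0 : {ffun T -> 'I_k}) (D : T -> {set 'I_k}) :
  symmetric e -> N \subset S -> {in N &, forall x y, ~~ e x y} ->
  proper_on e k S f0 ->
  #|[set f | (proper_on e k S f && (restrict_off N f == restrict_off N f0))
             && [forall x in N, f x \in D x]]|
  = (\prod_(u in N) #|available e k S f0 u :&: D u|)%N.
Proof.
move=> esym NS indep h0; rewrite -(card_product_off_fixed T k N f0).
apply: eq_card => f; rewrite [LHS]inE [RHS]inE.
apply/andP/forallP => [[/andP[hf /restrict_off_eq ff0] hD] x | h].
  rewrite (proper_on_off_fixed _ _ _ _ N f0) // in hf.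
  case: ifP => xN; last by rewrite ff0 // xN.
  by rewrite in_setI (forall_inP hf) // (forall_inP hD).
have ff0 x : x \notin N -> f x = f0 x.
  by move=> xN; have := h x; rewrite (negPf xN) => /eqP.
have hA x : x \in N -> f x \in available e k S f0 x :&: D x.
  by move=> xN; have := h x; rewrite xN.
split; last by apply/forall_inP => x /hA /setIP[].
rewrite (introT (restrict_off_eq _ _ _ _ _) ff0) andbT.
rewrite (proper_on_off_fixed _ _ _ _ N f0) //.
by apply/forall_inP => x /hA /setIP[].
Qed.

(** Double counting of pairs [(f, c)]: [c] is available at [v] exactly when no vertex of [N] has
    color [c]. *)
Lemma sum_available_class (T : finType) (e : rel T) (k : nat) (S N : {set T})
    (v : T) (f0 : {ffun T -> 'I_k}) :
  symmetric e -> N = [set u in S | e v u] -> {in N &, forall x y, ~~ e x y} ->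
  proper_on e k S f0 ->
  (\sum_(f | proper_on e k S f && (restrict_off N f == restrict_off N f0))
     #|available e k S f v|
   = \sum_c \prod_(u in N) #|available e k S f0 u :\ c|)%N.
Proof.
move=> esym NE indep h0.
have NS : N \subset S by apply/subsetP => u; rewrite NE inE => /andP[].
under eq_bigr do rewrite -sum1_card.
rewrite (exchange_big_dep xpredT) //=; apply: eq_bigr => c _.
under [RHS]eq_bigr do rewrite setDE.
rewrite -(card_proper_class T e k S N f0 (fun=> ~: [set c])) // -sum1_card.
apply: eq_bigl => f; rewrite [RHS]inE; congr andb.
apply/availableP/forall_inP => h w.
  by rewrite NE !inE => /andP[wS evw]; apply: h.
by move=> wS evw; have := h w; rewrite NE !inE wS evw; apply.
Qed.

(** The average list size at [v] is at least [expR (- a) * k], which is at least [2 * l], minus a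
    loss due to neighbors with short lists. The growth hypothesis on the sets [S :\ u] keeps that
    loss below [l]. *)
Lemma nproperU1_ge (R : realType) (T : finType) (e : rel T) (k : nat)
    (S : {set T}) (v : T) (eta a t0 l : R) :
  symmetric e -> irreflexive e ->
  (forall x y z, e x y -> e y z -> ~~ e z x) ->
  0 < eta -> 0 <= a -> 0 < l ->
  (1 + eta) * #|[set u in S | e v u]|%:R <= a * k%:R ->
  1 + eta <= eta * t0 ->
  2 * l <= expR (- a) * k%:R ->
  expR (- a) * (1 + a) * #|[set u in S | e v u]|%:R * t0 <= l ^+ 2 ->
  v \notin S ->
  (forall u, u \in S ->
     l * (nproper e k (S :\ u))%:R <= k%:R * (nproper e k S)%:R) ->
  l * (nproper e k S)%:R <= k%:R * (nproper e k (v |: S))%:R.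
Proof.
move=> esym eirr etri eta0 a0 l0; set N := [set u in S | e v u].
move=> hN ht hl hl2 vS IH.
have NS : N \subset S by apply/subsetP => u; rewrite inE => /andP[].
have indep : {in N &, forall x y, ~~ e x y}.
  move=> x y; rewrite !inE => /andP[_ evx] /andP[_ evy].
  by apply: (etri y v x) => //; rewrite esym.
have t0_ge0 : 0 <= t0 by nra.
pose B f := [set u in N | #|available e k S f u|%:R <= t0].
(* Within a class the lists of the vertices of [N] are constant, hence so is [B], and the estimate
   applies class by class. *)
have classwise : \sum_(f | proper_on e k S f) expR (- a) * (k%:R - (1 + a) * #|B f|%:R)
    <= \sum_(f | proper_on e k S f) #|available e k S f v|%:R :> R.
  rewrite (partition_big (restrict_off N) xpredT) //.
  rewrite [leRHS](partition_big (restrict_off N) xpredT) //.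
  apply: ler_sum => g _.
  have [f0 /andP[h0 /eqP <-] | no] :=
      pickP [pred f | proper_on e k S f & restrict_off N f == g]; last first.
    by rewrite !big_pred0.
  have BE f : proper_on e k S f && (restrict_off N f == restrict_off N f0) ->
      B f = B f0.
    move=> /andP[_ /restrict_off_eq ff0]; apply/setP => u; rewrite [LHS]inE [RHS]inE.
    case: (boolP (u \in N)) => //= uN; congr (_%:R <= t0); congr #|pred_of_set _|.
    apply: eq_available => w wS euw; apply: ff0.
    by apply: contraTN euw => wN; apply: indep.
  rewrite (eq_bigr (fun=> expR (- a) * (k%:R - (1 + a) * #|B f0|%:R))); last first.
    by move=> f /BE ->.
  rewrite sumr_const -[leLHS]mulr_natr -natr_sum (sum_available_class T e k S N v f0) //.
  have -> : #|[pred f | proper_on e k S f & restrict_off N f == restrict_off N f0]|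
      = (\prod_(u in N) #|available e k S f0 u|)%N.
    under [RHS]eq_bigr do rewrite -[available _ _ _ _ _]setIT.
    rewrite -(card_proper_class T e k S N f0 (fun=> setT)) //.
    apply: eq_card => f; rewrite [RHS]inE (introT forall_inP) ?andbT //.
  rewrite natr_prod natr_sum.
  under [leRHS]eq_bigr do rewrite natr_prod.
  rewrite -[k in k%:R - _]card_ord.
  apply: (@sum_prod_card_setD1_ge _ _ _ N (available e k S f0) eta a t0) => //.
    by rewrite card_ord.
  (* The lists are nonempty since [f0] itself is proper. *)
  move=> u uN; apply/set0Pn; exists (f0 u).
  apply/availableP => w wS euw; rewrite eq_sym.
  by move/proper_onP: h0; apply => //; apply: (subsetP NS).
(* Exchange the sums: each neighbor [u] of [v] has a short list in few colorings, by resampling at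
   [u] and the growth hypothesis for [S :\ u]. *)
have sumB : l * \sum_(f | proper_on e k S f) #|B f|%:R
    <= t0 * #|N|%:R * (nproper e k S)%:R.
  have -> : \sum_(f | proper_on e k S f) #|B f|%:R = \sum_(u in N)
      #|[set f | proper_on e k S f & #|available e k S f u|%:R <= t0]|%:R :> R.
    under eq_bigr do rewrite -sum1_card natr_sum.
    rewrite (exchange_big_dep (mem N)) /=; last by move=> f u _; rewrite inE => /andP[].
    apply: eq_bigr => u uN; rewrite -sum1_card natr_sum; apply: eq_bigl => f.
    by rewrite [RHS]inE [in LHS]inE uN.
  have k0 : 0 < k%:R :> R by have := expR_gt0 (- a); nra.
  have -> : t0 * #|N|%:R * (nproper e k S)%:R = \sum_(u in N) t0 * (nproper e k S)%:R.
    by rewrite sumr_const -[RHS]mulr_natr mulrAC.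
  rewrite mulr_sumr; apply: ler_sum => u uN.
  have uS := subsetP NS u uN.
  rewrite -(ler_pM2l k0) [leLHS]mulrCA [leRHS]mulrCA.
  apply: le_trans (ler_wpM2l (ltW l0) (card_few_available _ _ _ _ _ _ t0 esym eirr uS t0_ge0)) _.
  by rewrite [leLHS]mulrCA; apply: (ler_wpM2l t0_ge0 (IH u uS)).
have nP : \sum_(f | proper_on e k S f) #|available e k S f v|%:R
    = k%:R * (nproper e k (v |: S))%:R :> R.
  by rewrite -natr_sum sum_available // natrM.
rewrite -nP; apply: le_trans classwise.
rewrite -mulr_sumr sumrB -mulr_sumr sumr_const -[_ *+ #|_|]mulr_natr.
rewrite -[#|proper_on _ _ _|]cardsE -/(nproper e k S).
move: sumB hl hl2; set n := (nproper e k S)%:R; set s := \sum_(f | _) _.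
move=> hs hl hl2.
have n0 : 0 <= n by rewrite ler0n.
have c0 : 0 <= expR (- a) * (1 + a) by rewrite mulr_ge0 ?expR_ge0 // addr_ge0.
have hs' : expR (- a) * (1 + a) * s <= l * n.
  rewrite -(ler_pM2l l0); apply: (@le_trans _ _ (expR (- a) * (1 + a) * (t0 * #|N|%:R * n))).
    by rewrite mulrCA; apply: ler_wpM2l.
  by move: (ler_wpM2r n0 hl2); lra.
by move: (ler_wpM2r n0 hl); lra.
Qed.

Lemma triangle_free_colorable (R : realType) (T : finType) (e : rel T)
    (k : nat) (eta a : R) :
  symmetric e -> irreflexive e ->
  (forall x y z, e x y -> e y z -> ~~ e z x) ->
  0 < eta <= 1 -> 432 / eta ^+ 4 <= a -> expR ((1 + eta) * a) = k%:R ->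
  (forall v, (1 + eta) * #|[set u | e v u]|%:R <= a * k%:R) ->
  exists f : {ffun T -> 'I_k}, forall x y, e x y -> f x != f y.
Proof.
move=> esym eirr etri /andP[eta0 eta1] ha hk hdeg.
have eta4 : 0 < eta ^+ 4 by rewrite exprn_gt0.
have eta4_le1 : eta ^+ 4 <= 1 by apply: exprn_ile1 => //; apply: ltW.
rewrite ler_pdivrMr // in ha.
have a1 : 1 <= a by nra.
have kE : k%:R = expR a * expR (eta * a) by rewrite -hk mulrDl mul1r expRD.
have x0 := expR_gt0 (eta * a).
(* [l] is half of [expR (- a) * k], and [t0] gives equality in the condition bounding the loss by
   [l ^+ 2] when the degree is [a * k]. *)
pose l : R := expR (eta * a) / 2; pose t0 : R := expR (eta * a) / (4 * a * (1 + a)).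
have d0 : 0 < 4 * a * (1 + a) by nra.
have l0 : 0 < l by rewrite divr_gt0.
have ea : expR (- a) * k%:R = expR (eta * a).
  by rewrite kE mulrA -expRD addNr expR0 mul1r.
have ht : 1 + eta <= eta * t0.
  rewrite /t0 mulrA ler_pdivlMr //.
  (* A cubic lower bound for exp suffices; the constant 432 is [16 * 27]. *)
  have : (eta * a / 3) ^+ 3 <= expR (eta * a).
    have {2}-> : eta * a = 3%:R * (eta * a / 3) by field.
    have y0 : 0 <= eta * a / 3 by rewrite divr_ge0 ?mulr_ge0 //; lra.
    rewrite expRM_natl lerXn2r ?nnegrE ?expR_ge0 //.
    by apply: le_trans (expR_ge1Dx _); lra.
  move=> h; apply: (@le_trans _ _ (16 * a ^+ 2)); first by nra.
  apply: (@le_trans _ _ (eta * (eta * a / 3) ^+ 3)); last by rewrite ler_pM2l.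
  have -> : eta * (eta * a / 3) ^+ 3 = (a * eta ^+ 4) * a ^+ 2 / 27 by field.
  by have : 0 <= a ^+ 2 := sqr_ge0 a; nra.
have step (S : {set T}) v : v \notin S ->
    l * (nproper e k S)%:R <= k%:R * (nproper e k (v |: S))%:R.
  have [m Sm] := ubnP #|S|; elim: m S v Sm => // m IHm S v /ltnSE Sm vS.
  have hN : #|[set u in S | e v u]|%:R <= #|[set u | e v u]|%:R :> R.
    by rewrite ler_nat; apply/subset_leq_card/subsetP => u; rewrite !inE => /andP[].
  have k0 : 0 < k%:R :> R by rewrite kE mulr_gt0 ?expR_gt0.
  apply: (@nproperU1_ge _ _ _ _ _ _ eta a t0) => //.
  - by lra.
  - by move: (hdeg v); nra.
  - by rewrite ea /l; lra.
  - have : #|[set u in S | e v u]|%:R <= a * k%:R.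
      by move: (hdeg v) (ler0n R #|[set u | e v u]|); nra.
    move=> h; apply: (@le_trans _ _ (expR (- a) * (1 + a) * (a * k%:R) * t0)).
      rewrite ler_wpM2r //; first by rewrite divr_ge0 ?ltW.
      by rewrite ler_wpM2l // mulr_ge0 ?expR_ge0 //; lra.
    have -> : expR (- a) * (1 + a) * (a * k%:R) * t0
        = (expR (- a) * k%:R) * ((1 + a) * a * t0) by ring.
    rewrite ea /l /t0 le_eqVlt; apply/orP; left; apply/eqP; field.
    by rewrite !gt_eqF //; lra.
  - move=> u uS; rewrite -{2}(setD1K uS); apply: IHm; rewrite ?setD11 //.
    by apply: leq_trans Sm; rewrite [X in (_ < X)%N](cardsD1 u) uS.
(* Each added vertex multiplies the count by at least [l / k > 0], starting from the empty set. *)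
have pos (S : {set T}) : 0 < (nproper e k S)%:R :> R.
  have k0 : 0 < k%:R :> R by rewrite kE mulr_gt0 ?expR_gt0.
  have [m Sm] := ubnP #|S|; elim: m S Sm => // m IHm S /ltnSE Sm.
  have [->|[v vS]] := set_0Vmem S.
    rewrite ltr0n card_gt0; apply/set0Pn.
    rewrite ltr0n in k0; exists [ffun=> Ordinal k0].
    by rewrite inE; apply/proper_onP => x y; rewrite inE.
  have := step (S :\ v) v; rewrite setD11 setD1K // => /(_ isT) h.
  rewrite -(pmulr_rgt0 _ k0); apply: lt_le_trans h; rewrite mulr_gt0 //.
  by apply: IHm; apply: leq_trans Sm; rewrite [X in (_ < X)%N](cardsD1 v) vS.
have := pos setT; rewrite ltr0n card_gt0 => /set0Pn[f]; rewrite inE => /proper_onP h.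
by exists f => x y exy; apply: h.
Qed.

(** * Acyclic colorings and feedback arc sets *)

Section FeedbackArcSets.
Local Open Scope nat_scope.

(** Closed walks that repeat vertices are excluded as well, which is an equivalent condition. *)
Definition no_cycle {T : finType} (B : {set T * T}) : Prop :=
  forall c : seq T, c != [::] -> ~~ cycle (fun x y => (x, y) \in B) c.

(** Exchange argument: replace the arcs [Fv] of [F] at [v] by [X]. Closed walks through [v] are
    blocked by [X]; those avoiding [v] use no arc of [Fv] and are blocked by the rest of [F]. *)
Lemma min_feedback_le (T : finType) (A F X : {set T * T}) (v : T) :
  no_cycle (A :\: F) -> F \subset A -> X \subset A ->
  (forall F' : {set T * T}, F' \subset A -> no_cycle (A :\: F') -> #|F| <= #|F'|) ->
  (forall c, v \in c -> ~~ cycle (fun x y => (x, y) \in A :\: X) c) ->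
  #|[set p in F | (p.1 == v) || (p.2 == v)]| <= #|X|.
Proof.
move=> noF FA XA minF hX; set Fv := [set p in F | _].
have FvF : Fv \subset F by apply/subsetP => p; rewrite inE => /andP[].
suff : #|F| <= #|F :\: Fv :|: X|.
  move=> /leq_trans /(_ (leq_card_setU _ _)).
  by rewrite -(cardsID Fv F) (setIidPr FvF) addnC leq_add2l.
apply: minF => [|c c0].
  by rewrite subUset XA andbT; apply: subset_trans (subsetDl _ _) FA.
apply/negP => cyc; have [vc|vc] := boolP (v \in c).
  apply: (negP (hX c vc)); apply: sub_cycle cyc => x y.
  by rewrite !inE negb_or => /andP[/andP[_ ->] ->].
apply: (negP (noF c c0)).
apply: (@sub_in_cycle _ (fun x => x != v) _ _ _ c _ cyc); last first.
  by apply/allP => x xc; apply: contraNneq vc => <-.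
move=> x y xv yv; rewrite !inE /= => /andP[h ->]; rewrite andbT.
by apply: contra h => xyF; rewrite xyF !(negPf xv, negPf yv) andbF.
Qed.

(* A feedback arc set of minimum size: replacing its arcs at v by all arcs
   leaving (or all arcs entering) v gives another feedback arc set. *)
Lemma feedback_arc_set (T : finType) (A : {set T * T}) :
  exists F : {set T * T}, [/\ F \subset A, no_cycle (A :\: F) &
    forall v, #|[set p in F | (p.1 == v) || (p.2 == v)]| <= #|[set w | (v, w) \in A]| /\
              #|[set p in F | (p.1 == v) || (p.2 == v)]| <= #|[set w | (w, v) \in A]|].
Proof.
pose P (F : {set T * T}) := (F \subset A) && `[< no_cycle (A :\: F) >].
have PA : P A.
  rewrite /P subxx; apply/asboolP => -[//|x c] _.
  rewrite setDv; apply/negP => cyc.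
  by have := next_cycle cyc (mem_head x c); rewrite inE.
case: (arg_minnP (fun F : {set T * T} => #|F|) PA) => F /andP[FA /asboolP noF] minF.
have {}minF (F' : {set T * T}) : F' \subset A -> no_cycle (A :\: F') -> #|F| <= #|F'|.
  by move=> F'A noF'; apply: minF; rewrite /P F'A; apply/asboolP.
exists F; split => // v; split.
- have inj : injective (fun w : T => (v, w)) by move=> x y [].
  rewrite -(card_imset _ inj); apply: (min_feedback_le T A) => //.
    by apply/subsetP => p /imsetP[w + ->]; rewrite inE.
  move=> c vc; apply/negP => cyc; have := next_cycle cyc vc.
  rewrite in_setD => /andP[/imsetP h cA].
  by apply: h; exists (next c v); rewrite ?inE.
- have inj : injective (fun w : T => (w, v)) by move=> x y [].
  rewrite -(card_imset _ inj); apply: (min_feedback_le T A) => //.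
    by apply/subsetP => p /imsetP[w + ->]; rewrite inE.
  move=> c vc; apply/negP => cyc; have := prev_cycle cyc vc.
  rewrite in_setD => /andP[/imsetP h cA].
  by apply: h; exists (prev c v); rewrite ?inE.
Qed.

(** Unlike in [acyclic_partition], color classes may be empty; colors in [nat] make it easy to add a
    fresh color [k]. *)
Definition dicolorable_on {T : finType} (D : digraph T) (S : {set T}) (k : nat) : Prop :=
  exists2 col : T -> nat, {in S, forall x, col x < k} &
    forall (c : seq T) (j : nat), directed_cycle D c -> {subset c <= S} ->
      ~ {in c, forall x, col x = j}.

Lemma directed_cycle_arc (T : finType) (D : digraph T) (c : seq T) :
  directed_cycle D c -> exists x y, [/\ x \in c, y \in c & Defs.arc D x y].
Proof.
case: c => [|x c] /and3P[// _ _ cyc]; exists x, (next (x :: c) x).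
by split; [exact: mem_head | rewrite mem_next mem_head | apply: next_cycle (mem_head _ _)].
Qed.

Lemma edge_sym (T : finType) (G : sgraph T) : symmetric (edge G).
Proof. by move=> x y; rewrite /edge setUC. Qed.

Lemma edge_irr (T : finType) (G : sgraph T) : irreflexive (edge G).
Proof.
move=> x; apply/negP; rewrite /edge setUid => h.
by have := forall_inP (valP G) _ h; rewrite cards1.
Qed.

Lemma triangle_freeP (T : finType) (G : sgraph T) : triangle_free G ->
  forall x y z, edge G x y -> edge G y z -> ~~ edge G z x.
Proof.
move=> /existsPn h x y z xy yz; apply/negP => zx; have := h x.
by move=> /existsPn/(_ y)/existsPn/(_ z); rewrite xy yz zx.
Qed.

Lemma orientation_arc (T : finType) (G : sgraph T) (D : digraph T) (x y : T) :
  is_orientation G D -> Defs.arc D x y -> edge G x y && ~~ Defs.arc D y x.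
Proof.
move=> /forallP/(_ x)/forallP/(_ y); case: (edge G x y) => [h xy|/negP h /h //].
by move: h; rewrite xy; case: (Defs.arc D y x).
Qed.

Lemma dicolorable_on_card (T : finType) (D : digraph T) (S : {set T}) :
  dicolorable_on D S #|S|.
Proof.
exists (fun x => index x (enum S)) => [x xS|c j /directed_cycle_arc[x [y [xc yc xy]]] cS cj].
  by rewrite cardE index_mem mem_enum.
have xy' : x = y.
  have xS := cS x xc; have yS := cS y yc.
  by rewrite -(nth_index x (s := enum S) (x := x)) ?mem_enum // (cj x) //
    -(cj y) // nth_index ?mem_enum.
by move: xy; rewrite xy' /Defs.arc (negPf (forallP (valP D) y)).
Qed.

(** A neighborhood in a triangle-free graph spans no arc, so it can receive the fresh color [k]. *)
Lemma dicolorable_on_remove_nbhd (T : finType) (G : sgraph T) (D : digraph T)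
    (S : {set T}) (v : T) (k : nat) :
  triangle_free G -> is_orientation G D ->
  dicolorable_on D (S :\: [set w in S | edge G v w]) k ->
  dicolorable_on D S k.+1.
Proof.
move=> tf orD [col colk hcol]; set N := [set w in S | _] in colk hcol *.
exists (fun x => if x \in N then k else col x) => [x xS | c j cyc cS cj].
  case: ifP => // xN; apply: ltnW; rewrite ltnS colk //.
  by rewrite in_setD xN.
have [jk|jk] := eqVneq j k; last first.
  apply: (hcol c j cyc) => x xc; last first.
    by move: (cj x xc); case: ifP => // _ /eqP; rewrite eq_sym (negPf jk).
  rewrite in_setD cS // andbT; apply/negP => xN; move: (cj x xc).
  by rewrite xN => /eqP; rewrite eq_sym (negPf jk).
have cN x : x \in c -> x \in N.
  move=> xc; move: (cj x xc); case: ifP => // xN xj.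
  have : col x < k by apply: colk; rewrite in_setD xN cS.
  by rewrite xj jk ltnn.
have [x [y [/cN xN /cN yN xy]]] := directed_cycle_arc T D c cyc.
move: xN yN; rewrite !inE => /andP[_ vx] /andP[_ vy].
have /andP[exy _] := orientation_arc T G D x y orD xy.
by have := triangle_freeP T G tf v x y vx exy; rewrite edge_sym vy.
Qed.

(** The nonempty color classes form a partition into at most [k] parts, possibly fewer. *)
Lemma dichromatic_number_le (T : finType) (D : digraph T) (k : nat) :
  dicolorable_on D [set: T] k -> dichromatic_number D <= k.
Proof.
move=> [col colk hcol]; rewrite /dichromatic_number; case: ex_minnP => m _ minm.
pose P := preim_partition col [set: T].
have hP : partition P [set: T] := preim_partitionP _ _.
apply: (@leq_trans #|P|).
  apply: minm; apply/asboolP; exists P; split => // A AP c cyc cA.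
  have /imsetP[x _ AE] := AP.
  apply: (hcol c (col x) cyc) => y; first by rewrite inE.
  by move/cA; rewrite AE !inE => /eqP ->.
have: P \subset [set [set y | j == col y :> nat] | j : 'I_k].
  apply/subsetP => A /imsetP[x _ ->].
  apply/imsetP; exists (Ordinal (colk x (in_setT x))) => //.
  by apply/setP => y; rewrite !inE.
move/subset_leq_card/leq_trans; apply; apply: leq_trans (leq_imset_card _ _) _.
by rewrite card_ord.
Qed.
End FeedbackArcSets.

(** Properly color the graph [e] underlying a minimum feedback arc set [F]: a monochromatic cycle
    would avoid [F]. Degrees in [e] are at most half of those in [G], whence the factor 2 in the
    degree hypothesis. *)
Lemma dicolorable_on_low_degree (R : realType) (T : finType) (G : sgraph T)
    (D : digraph T) (S : {set T}) (k : nat) (eta a : R) :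
  triangle_free G -> is_orientation G D ->
  0 < eta <= 1 -> 432 / eta ^+ 4 <= a -> expR ((1 + eta) * a) = k%:R ->
  (forall v, v \in S ->
     (1 + eta) * #|[set w in S | edge G v w]|%:R <= 2 * (a * k%:R)) ->
  dicolorable_on D S k.
Proof.
move=> tf orD eta01 ha hk hdeg.
pose A := [set p : T * T | [&& p.1 \in S, p.2 \in S & Defs.arc D p.1 p.2]].
have [F [FA noF hF]] := feedback_arc_set T A.
pose e x y := ((x, y) \in F) || ((y, x) \in F).
have esym : symmetric e by move=> x y; rewrite /e orbC.
have FS x y : (x, y) \in F -> [/\ x \in S, y \in S & Defs.arc D x y].
  by move/(subsetP FA); rewrite inE => /and3P.
have eG x y : e x y -> edge G x y.
  by move=> /orP[] /FS[_ _ /(orientation_arc T G D _ _ orD)/andP[]//]; rewrite edge_sym.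
have eirr : irreflexive e.
  by move=> x; apply/negP => /eG; rewrite edge_irr.
have etri x y z : e x y -> e y z -> ~~ e z x.
  move=> /eG xy /eG yz; apply/negP => /eG.
  by apply/negP; apply: triangle_freeP xy yz.
have a0 : 0 <= a.
  by apply: le_trans ha; case/andP: eta01 => ? _; rewrite divr_ge0 // exprn_ge0 // ltW.
have ecard v : (#|[set u | e v u]| <= #|[set p in F | (p.1 == v) || (p.2 == v)]|)%N.
  pose other (p : T * T) := if p.1 == v then p.2 else p.1.
  apply: leq_trans (leq_imset_card other _); apply/subset_leq_card/subsetP => u.
  rewrite inE => /orP[] h; apply/imsetP.
    by exists (v, u); rewrite ?inE /other /= ?eqxx ?h.
  exists (u, v); rewrite ?inE /other /= ?eqxx ?h ?orbT //.
  by case: eqP => // uv; have := eirr u; rewrite /e {2}uv h.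
have edeg v : (1 + eta) * #|[set u | e v u]|%:R <= a * k%:R.
  have [hout hin] := hF v.
  have [vS|vS] := boolP (v \in S); last first.
    have -> : [set u | e v u] = set0.
      apply/setP => u; rewrite !inE; apply/negP => /orP[] /FS[]; last by rewrite (negPf vS).
      by rewrite (negPf vS).
    by rewrite cards0 mulr0 mulr_ge0.
  (* Out- and in-neighborhoods are disjoint because an orientation has no 2-cycle. *)
  have : (#|[set w | (v, w) \in A]| + #|[set w | (w, v) \in A]|
          <= #|[set w in S | edge G v w]|)%N.
    rewrite -cardsUI [X in (_ + X)%N](_ : _ = 0%N) ?addn0; last first.
      apply/eqP; rewrite cards_eq0; apply/eqP/setP => w; rewrite !inE /= vS /=.
      apply/negP => /andP[/andP[_ vw] /andP[_ wv]].
      by have /andP[_] := orientation_arc T G D _ _ orD vw; rewrite wv.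
    apply/subset_leq_card/subsetP => w; rewrite !inE /= vS /=.
    case/orP => /andP[-> /(orientation_arc T G D _ _ orD)/andP[]] //=.
    by rewrite edge_sym.
  have := ecard v; have := hdeg v vS; set d := #|_|; set x := #|[set u | e v u]|.
  move=> hd xF hs.
  have : (2 * x <= d)%N.
    apply: leq_trans hs; rewrite mul2n -addnn.
    by apply: leq_add; apply: leq_trans xF _.
  rewrite -(ler_nat R) natrM => h2; move: hd.
  by case/andP: eta01 => ? _; nra.
have [f hf] := triangle_free_colorable R T e k eta a esym eirr etri eta01 ha hk edeg.
exists (fun x => nat_of_ord (f x)) => [x _ //|c j cyc cS cj].
case/and3P: cyc => c0 _ cyc; apply: (negP (noF c c0)).
apply: (@sub_in_cycle _ (mem c) _ _ _ c _ cyc); last by apply/allP.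
move=> x y xc yc xy; rewrite !inE /= cS // cS // xy !andbT.
apply/negP => xyF; have := hf x y; rewrite /e xyF => /(_ isT) /eqP; apply.
by apply/val_inj; rewrite /= (cj x xc) (cj y yc).
Qed.

(** * Removing neighborhoods of large degree *)

(** Induction on the size of [S]. For large [S], either [k], the integer part of [c * sqrt #|S|], is
    enough colors, or some neighborhood takes one color and its removal lowers [c * sqrt #|S|] by at
    least 1. [lam] bounds [ln k] from below; [A] pays for the small sets. *)
Lemma dicolorable_on_peel (R : realType) (T : finType) (G : sgraph T)
    (D : digraph T) (eta lam c A : R) :
  triangle_free G -> is_orientation G D ->
  0 < eta <= 1 -> 864 / eta ^+ 4 <= lam -> 0 < c ->
  (1 + eta) ^+ 3 <= c ^+ 2 * lam -> 0 <= A ->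
  (forall S : {set T}, c * Num.sqrt #|S|%:R < (1 + eta) * expR lam ->
     exists2 k, dicolorable_on D S k & k%:R <= A) ->
  forall S : {set T},
    exists2 k, dicolorable_on D S k & k%:R <= A + c * Num.sqrt #|S|%:R.
Proof.
move=> tf orD eta01 hlam c0 hc A0 base S.
have [m Sm] := ubnP #|S|; elim: m S Sm => // m IHm S /ltnSE Sm.
have /andP[eta0 eta1] := eta01.
have eta4 : 0 < eta ^+ 4 by rewrite exprn_gt0.
have eta4_le : eta ^+ 4 <= eta.
  by rewrite -[leRHS]expr1; apply: ler_wiXn2l => //; apply: ltW.
set x := Num.sqrt #|S|%:R.
have x_ge0 : 0 <= x := sqrtr_ge0 _.
have [small|big] := ltP (c * x) ((1 + eta) * expR lam).
  have [k kS kA] := base S small; exists k => //.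
  by apply: le_trans kA _; rewrite lerDl mulr_ge0 // ltW.
have lam_eta : 864 <= lam * eta ^+ 4 by rewrite -ler_pdivrMr.
have lam0 : 0 < lam by nra.
(* This makes the loss from rounding [c * x] down at most a factor [1 + eta]. *)
have elam : 1 <= eta * expR lam.
  apply: (@le_trans _ _ (eta * lam)); last first.
    by rewrite ler_pM2l //; apply: le_trans (expR_ge1Dx _); rewrite lerDr.
  by nra.
have K0 : 0 <= c * x by rewrite mulr_ge0 // ltW.
pose k := Num.truncn (c * x).
have /andP[kK Kk] := truncn_itv K0; rewrite -/k -natr1 in kK Kk.
have kK' : c * x <= (1 + eta) * k%:R by nra.
have k_ge : expR lam <= k%:R by nra.
have k0 : 0 < k%:R :> R by apply: lt_le_trans k_ge; apply: expR_gt0.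
pose a : R := ln k%:R / (1 + eta).
have aE : (1 + eta) * a = ln k%:R by rewrite /a mulrC divfK // gt_eqF //; lra.
have hk : expR ((1 + eta) * a) = k%:R by rewrite aE lnK // posrE.
have lam_le : lam <= ln k%:R by rewrite -ler_expR lnK // posrE.
have ha : 432 / eta ^+ 4 <= a by rewrite ler_pdivrMr //; nra.
have a0 : 0 < a by nra.
have [hdeg|] := boolP [forall v in S,
    (1 + eta) * #|[set w in S | edge G v w]|%:R <= 2 * (a * k%:R)].
  exists k; last by apply: le_trans kK _; rewrite lerDr.
  by apply: (dicolorable_on_low_degree R T G D S k eta a) => //; apply/forall_inP.
rewrite negb_forall_in => /existsP[v /andP[vS]]; rewrite -ltNge.
set N := [set w in S | edge G v w] => hN.
have NS : N \subset S by apply/subsetP => w; rewrite inE => /andP[].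
have SN : (#|S :\: N| + #|N| = #|S|)%N by rewrite -(cardsID N S) (setIidPr NS) addnC.
have ak : 0 < a * k%:R by apply: mulr_gt0.
have N0 : 0 < #|N|%:R :> R by nra.
have [k' k'col k'le] : exists2 k', dicolorable_on D (S :\: N) k'
    & k'%:R <= A + c * Num.sqrt #|S :\: N|%:R.
  apply: IHm; apply: leq_trans Sm; rewrite -SN -[X in (X < _)%N]addn0 ltn_add2l.
  by rewrite -(ltr_nat R).
exists k'.+1; first exact: dicolorable_on_remove_nbhd tf orD k'col.
rewrite -natr1; set y := Num.sqrt _ in k'le.
have y0 : 0 <= y := sqrtr_ge0 _.
have xy : x ^+ 2 = y ^+ 2 + #|N|%:R.
  by rewrite /x /y !sqr_sqrtr // -natrD SN.
have yx : y < x by rewrite -ltr_sqr ?nnegrE //; lra.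
have x0 : 0 < x by lra.
(* Since [x - y = #|N| / (x + y) >= #|N| / (2 * x)], this says that the fresh color is paid for by
   the decrease of [c * sqrt]. *)
have cr : 2 * x <= c * #|N|%:R.
  have e3 : 0 < (1 + eta) ^+ 3 by rewrite exprn_gt0 //; lra.
  rewrite -(ler_pM2l e3).
  apply: (@le_trans _ _ (2 * (c ^+ 2 * lam) * x)).
    by rewrite mulrCA mulrA ler_wpM2r // ler_wpM2l.
  apply: (@le_trans _ _ (2 * c * lam * ((1 + eta) * k%:R))).
    have -> : 2 * (c ^+ 2 * lam) * x = 2 * c * lam * (c * x) by ring.
    by rewrite ler_wpM2l // ?mulr_ge0 // ltW.
  apply: (@le_trans _ _ (c * (1 + eta) ^+ 2 * (2 * (a * k%:R)))).
    have -> : c * (1 + eta) ^+ 2 * (2 * (a * k%:R))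
        = 2 * c * ((1 + eta) * a) * ((1 + eta) * k%:R) by ring.
    rewrite aE; apply: ler_wpM2r; first by rewrite mulr_ge0 ?(ltW k0) //; lra.
    by apply: ler_wpM2l => //; lra.
  have -> : (1 + eta) ^+ 3 * (c * #|N|%:R) = c * (1 + eta) ^+ 2 * ((1 + eta) * #|N|%:R) by ring.
  apply: ler_wpM2l; last exact: ltW.
  by apply: mulr_ge0; [exact: ltW | apply: exprn_ge0; lra].
have : 1 <= c * (x - y).
  rewrite -(ler_pM2r x0) -(ler_pM2l (ltr0Sn R 1)) mul1r.
  apply: le_trans cr _.
  have -> : 2 * (c * (x - y) * x) = c * (2 * x * (x - y)) by ring.
  by apply: ler_wpM2l; [exact: ltW | nra].
by lra.
Qed.

(** Peeling with [eta = 1], [lam = 864], [c = 1]; the small sets then have bounded size and get one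
    color per vertex. *)
Lemma dicolorable_on_crude (R : realType) :
  exists2 A : R, 0 <= A & forall (T : finType) (G : sgraph T) (D : digraph T)
    (S : {set T}), triangle_free G -> is_orientation G D ->
    exists2 k, dicolorable_on D S k & k%:R <= A + Num.sqrt #|S|%:R.
Proof.
have h0 : 0 < (1 + 1) * expR 864 :> R by apply: mulr_gt0; [lra | apply: expR_gt0].
exists (((1 + 1) * expR 864) ^+ 2) => [|T G D S tf orD]; first exact: sqr_ge0.
rewrite -[Num.sqrt _]mul1r.
apply: (dicolorable_on_peel R T G D 1 864) => //.
- by rewrite ltr01 lexx.
- by rewrite expr1n divr1.
- by rewrite expr1n mul1r; lra.
- exact: sqr_ge0.
- move=> S' hS'; exists #|S'|; first exact: dicolorable_on_card.
  rewrite mul1r in hS'; rewrite -[leLHS]sqr_sqrtr //.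
  by apply: lerXn2r; rewrite ?nnegrE ?sqrtr_ge0 ?ltW.
Qed.

(** * Choice of parameters and asymptotics *)

Lemma natr_bigmax_le (R : realType) (I : finType) (P : pred I) (F : I -> nat) (X : R) :
  0 <= X -> (forall i, P i -> (F i)%:R <= X) -> (\max_(i | P i) F i)%:R <= X.
Proof.
move=> X0 hF; elim/big_ind: _ => // m n hm hn.
by case: (leqP m n) => h; rewrite ?(maxn_idPr h) ?(maxn_idPl (ltnW h)).
Qed.

Lemma graph_dichromatic_number_le (R : realType) (eps : R) : 0 < eps ->
  exists n0 : nat, forall (T : finType) (G : sgraph T),
    (n0 <= #|T|)%N -> triangle_free G ->
    (graph_dichromatic_number G)%:R
      <= (1 + eps) * Num.sqrt (2 * #|T|%:R / ln (#|T|%:R : R)).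
Proof.
move=> eps0.
have [A1 A1_ge0 crude] := dicolorable_on_crude R.
(* The final factor is [(1 + eta) ^+ 2 + eta], at most [1 + 4 * eta]. *)
pose eta : R := Num.min 1 (eps / 4).
have eta0 : 0 < eta by rewrite lt_min ltr01 divr_gt0.
have eta1 : eta <= 1 by rewrite ge_min lexx.
have eta_eps : eta <= eps / 4 by rewrite ge_min lexx orbT.
have eta4 : 0 < eta ^+ 4 by rewrite exprn_gt0.
(* A lower bound for [x = ln n / 2]: the term 1728, twice 864, ensures the lower bound on
   [lam >= x / 2], and [16 * (A1 + 1)] makes the cost [A] of the small sets negligible. *)
pose X : R := (16 * (A1 + 1) + 1728) / eta ^+ 4.
exists (Num.truncn (expR (2 * X))).+1 => T G hn tf.
set n := #|T| in hn *.
have n_gt : expR (2 * X) < n%:R by apply: lt_le_trans (truncnS_gt _) _; rewrite ler_nat.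
have n0 : 0 < n%:R :> R by apply: lt_trans n_gt; apply: expR_gt0.
pose x : R := ln n%:R / 2.
have L2 : ln n%:R = 2 * x by rewrite /x; field.
have hx : 16 * (A1 + 1) + 1728 <= x * eta ^+ 4.
  rewrite -ler_pdivrMr // -/X.
  have : 2 * X <= ln n%:R by rewrite -ler_expR lnK ?posrE // ltW.
  by rewrite L2; lra.
have eta4_le : eta ^+ 4 <= eta ^+ 3 by apply: ler_wiXn2l => //; apply: ltW.
have eta3_le1 : eta ^+ 3 <= 1 by apply: exprn_ile1 => //; apply: ltW.
have x1 : 1 <= x by nra.
have x0 : 0 < x by lra.
have hx3 : 16 * (A1 + 1) <= eta ^+ 3 * x by nra.
have ne : n%:R = expR x ^+ 2 by rewrite -expRM_natl -L2 lnK // posrE.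
pose q := Num.sqrt x.
have q0 : 0 < q by rewrite sqrtr_gt0.
have qq : q ^+ 2 = x by rewrite sqr_sqrtr // ltW.
have sqn : Num.sqrt n%:R = expR x by rewrite ne sqrtr_sqr ger0_norm // expR_ge0.
have -> : 2 * n%:R / ln n%:R = (expR x / q) ^+ 2 :> R.
  by rewrite L2 ne expr_div_n qq; field; rewrite gt_eqF.
rewrite sqrtr_sqr ger0_norm; last by rewrite divr_ge0 ?expR_ge0 // ltW.
(* [expR lam] is the square root of [n] to the power [1 / (1 + eta)], so the small sets are
   polynomially smaller than [n], while [c] satisfies the peeling condition with equality. *)
pose lam := x / (1 + eta); pose c := (1 + eta) ^+ 2 / q.
have e0 : 0 < 1 + eta by lra.
have xlam : x = lam + eta * lam by rewrite /lam; field; rewrite gt_eqF.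
have lam0 : 0 < lam by rewrite divr_gt0.
have lamx : x <= 2 * lam by nra.
have hlam : 864 / eta ^+ 4 <= lam by rewrite ler_pdivrMr //; nra.
have c0 : 0 < c by rewrite divr_gt0 // exprn_gt0.
have hc : c ^+ 2 * lam = (1 + eta) ^+ 3.
  by rewrite /c /lam expr_div_n qq; field; rewrite !gt_eqF.
(* The crude bound on a set with [c * sqrt #|S| < (1 + eta) * expR lam]. *)
pose A := A1 + (1 + eta) * expR lam / c.
have A0 : 0 <= A.
  apply: addr_ge0 => //; apply: divr_ge0; last exact: ltW.
  by apply: mulr_ge0; [exact: ltW | exact: expR_ge0].
have small_rest : A <= eta * (expR x / q).
  have elam0 := expR_gt0 lam.
  have elam1 : 1 <= expR lam by apply: le_trans (expR_ge1Dx _); lra.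
  (* The gap between [expR x] and [expR lam] is [expR (eta * lam)], which beats [x] by a quadratic
     lower bound for exp. *)
  have xe : x * (A1 + 1) <= eta * expR (eta * lam).
    have : (eta * lam / 2) ^+ 2 <= expR (eta * lam).
      have {2}-> : eta * lam = 2%:R * (eta * lam / 2) by field.
      have y0 : 0 <= eta * lam / 2.
        by apply: ltW; apply: divr_gt0; [apply: mulr_gt0 |].
      rewrite expRM_natl lerXn2r ?nnegrE ?expR_ge0 //.
      by apply: le_trans (expR_ge1Dx _); lra.
    move=> h; apply: (@le_trans _ _ (eta * (eta * lam / 2) ^+ 2)); last by rewrite ler_pM2l.
    have -> : eta * (eta * lam / 2) ^+ 2 = eta ^+ 3 * lam ^+ 2 / 4 by field.
    have l2 : x ^+ 2 <= 4 * lam ^+ 2 by nra.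
    have : eta ^+ 3 * x ^+ 2 <= eta ^+ 3 * (4 * lam ^+ 2).
      by rewrite ler_pM2l // exprn_gt0.
    have : x * (16 * (A1 + 1)) <= x * (eta ^+ 3 * x) by rewrite ler_pM2l.
    by lra.
  rewrite mulrA ler_pdivlMr //.
  have -> : A * q = A1 * q + expR lam * x / (1 + eta).
    by rewrite /A /c -qq; field; rewrite !gt_eqF.
  apply: (@le_trans _ _ (x * (A1 + 1) * expR lam)); last first.
    by rewrite {2}xlam expRD; move: (ler_wpM2r (ltW elam0) xe); lra.
  have qx : q <= x by nra.
  have h1 : A1 * q <= A1 * x by rewrite ler_wpM2l.
  have h2 : A1 * x <= A1 * x * expR lam by rewrite ler_peMr // mulr_ge0 // ltW.
  have h3 : expR lam * x / (1 + eta) <= expR lam * x.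
    by rewrite ler_pdivrMr // ler_peMr ?mulr_ge0 ?expR_ge0 ?ltW //; lra.
  by lra.
have s0 : 0 <= expR x / q by rewrite divr_ge0 ?expR_ge0 // ltW.
apply: natr_bigmax_le => [|D orD]; first by rewrite mulr_ge0 //; lra.
have [k kcol kle] : exists2 k, dicolorable_on D [set: T] k &
    k%:R <= A + c * Num.sqrt #|[set: T]|%:R.
  apply: (dicolorable_on_peel R T G D eta lam c A) => //.
  - by rewrite eta0.
  - by rewrite hc.
  - move=> S hS; have [k kS kA] := crude T G D S tf orD; exists k => //.
    apply: le_trans kA _; rewrite lerD2l ler_pdivlMr // mulrC; exact: ltW.
apply: (@le_trans _ _ k%:R); first by rewrite ler_nat dichromatic_number_le.
apply: le_trans kle _; rewrite cardsT sqn.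
have -> : c * expR x = (1 + eta) ^+ 2 * (expR x / q) by rewrite /c; field; rewrite gt_eqF.
move: small_rest s0; set s := expR x / q => h s0.
have : 0 <= (eps - 4 * eta) * s by rewrite mulr_ge0 //; lra.
have : 0 <= eta * (1 - eta) * s by apply: mulr_ge0 => //; apply: mulr_ge0; lra.
by lra.
Qed.

Theorem mainTheorem9 (R : realType) :
  (forall eps : R, 0 < eps ->
     exists n0 : nat, forall (T : finType) (G : sgraph T),
       (n0 <= #|T|)%N -> triangle_free G ->
       (graph_dichromatic_number G)%:R
         <= (1 + eps) * Num.sqrt (2 * #|T|%:R / ln (#|T|%:R : R)))
  /\
  (forall eps : R, 0 < eps ->
     exists n0 : nat, forall n : nat, (n0 <= n)%N ->
       (max_triangle_free_dichromatic n)%:R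
         <= (Num.sqrt 2 + eps) * Num.sqrt (n%:R / ln (n%:R : R))).
Proof.
split => eps eps0; first exact: graph_dichromatic_number_le.
have [|n0 hn0] := graph_dichromatic_number_le R (eps / 2); first by rewrite divr_gt0.
exists n0 => n n0n.
(* Hence [(1 + eps / 2) * sqrt 2 <= sqrt 2 + eps]. *)
have h2 : Num.sqrt 2 <= 2 :> R.
  by rewrite -[leRHS]ger0_norm // -sqrtr_sqr ler_wsqrtr //; lra.
have h20 : 0 <= Num.sqrt 2 :> R := sqrtr_ge0 _.
apply: natr_bigmax_le => [|G tf].
  by rewrite mulr_ge0 ?sqrtr_ge0 // addr_ge0 // ltW.
have := hn0 'I_n G; rewrite card_ord => /(_ n0n tf) /le_trans; apply.
rewrite -mulrA sqrtrM // mulrA ler_wpM2r ?sqrtr_ge0 //.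
by nra.
Qed.
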